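(* Let $\Omega$ be a weakly compact and convex subset of a Banach space $E$ (in particular, $\Omega = B_E$ where $E$ is reflexive). Then for every $x \in \Omega$ there is a sequence $(x_n)_{n\ge1}$ of extreme points of $\Omega$ which is Cesàro summable to $x$.
   Context: Banach spaces are real. $B_E$ is the closed unit ball of $E$. A sequence $(x_n)$ is Cesàro summable to $x$ if $\frac{x_1 + \dots + x_N}{N} \to x$ in norm as $N \to \infty$. *)

(* Defs.v *)
From HB Require Import structures.
From mathcomp Require Import all_boot all_order all_algebra.
From mathcomp Require Import all_classical all_reals.
From mathcomp Require Import topology normedtype sequences convex.

Set Implicit Arguments.
Unset Strict Implicit.
Unset Printing Implicit Defensive.

Import Order.TTheory GRing.Theory Num.Theory.
Import numFieldNormedType.Exports.

Local Open Scope classical_set_scope.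
Local Open Scope ring_scope.

Section Dual.
Context (R : realType) (E : normedModType R).

Definition contlin : {pred E -> R} :=
  [pred f : E -> R | `[< linear (f : E -> R^o) /\ continuous f >]].

Record dual := Dual { dual_fun :> E -> R ; _ : dual_fun \in contlin }.

HB.instance Definition _ := [isSub for dual_fun].
HB.instance Definition _ := [Choice of dual by <:].

Lemma contlinP (f : E -> R) :
  (f \in contlin) <-> linear (f : E -> R^o) /\ continuous f.
Proof. by split=> [/asboolP|/asboolP]. Qed.

Lemma contlin_submod_closed : submod_closed contlin.
Proof.
split=> [|a f g /contlinP[lf cf] /contlinP[lg cg]]; apply/contlinP; split.
- by move=> a x y; rewrite [RHS]addr0 [RHS]scaler0.
- by move=> x; exact: cvg_cst.
- move=> b x y /=; rewrite -[LHS]/(a * f (b *: x + y) + g (b *: x + y)).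
  rewrite lf lg -[RHS]/(b * (a * f x + g x) + (a * f y + g y)).
  by rewrite /GRing.scale/= !mulrDr (mulrCA a b) addrACA.
- move=> x; rewrite /continuous_at; apply: cvgD; last exact: cg.
  by apply: (@cvgMl_tmp R E (nbhs x) _ f a); exact: cf.
Qed.

HB.instance Definition _ :=
  GRing.isSubmodClosed.Build _ _ contlin contlin_submod_closed.

HB.instance Definition _ := [SubChoice_isSubLmodule of dual by <:].

Implicit Types f g : dual.

Lemma dualP f : linear (f : E -> R^o) /\ continuous f.
Proof. by apply/contlinP; case: f. Qed.

Lemma dual_linear f : linear (f : E -> R^o). Proof. exact: (dualP f).1. Qed.

HB.instance Definition _ f :=
  GRing.isLinear.Build R E R^o _ (f : E -> R^o) (dual_linear f).

Lemma dual0 f : f 0 = 0.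
Proof. exact: (linear0 (f : {linear E -> R^o})). Qed.

Lemma dualZ f a x : f (a *: x) = a * f x.
Proof. exact: (linearZZ (f : {linear E -> R^o})). Qed.

Definition dual_norm f : R := sup [set `|f x| | x in [set x : E | `|x| <= 1]].

Lemma dual_has_sup f : has_sup [set `|f x| | x in [set x : E | `|x| <= 1]].
Proof.
split; first by exists `|f 0|; exists 0 => //=; rewrite normr0.
have cf : continuous (f : E -> R^o) by exact: (dualP f).2.
have /linear_boundedP/pinfty_ex_gt0[r r0 rf] :=
  @continuous_linear_bounded _ _ _ 0 f (cf 0).
exists r => _ [x /= x1 <-]; apply: (le_trans (rf x)).
by rewrite -[leRHS]mulr1 ler_wpM2l// ltW.
Qed.

Lemma dual_norm_ub f x : `|x| <= 1 -> `|f x| <= dual_norm f.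
Proof. by move=> x1; apply: sup_upper_bound; [exact: dual_has_sup|exists x]. Qed.

Lemma dual_norm_le f M : (forall x, `|x| <= 1 -> `|f x| <= M) -> dual_norm f <= M.
Proof.
move=> fM; apply: ge_sup; first exact: (dual_has_sup f).1.
by move=> _ [x /= x1 <-]; exact: fM.
Qed.

Lemma dual_norm_ge0 f : 0 <= dual_norm f.
Proof. by rewrite (le_trans _ (dual_norm_ub f (x := 0) _)) ?normr0. Qed.

Lemma dual_normD f g : dual_norm (f + g) <= dual_norm f + dual_norm g.
Proof.
apply: dual_norm_le => x x1; rewrite -[(f + g) x]/(f x + g x).
by rewrite (le_trans (ler_normD _ _))// lerD// dual_norm_ub.
Qed.

Lemma dual_normZ (a : R) f : dual_norm (a *: f) = `|a| * dual_norm f.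
Proof.
have le b h : dual_norm (b *: h) <= `|b| * dual_norm h.
  apply: dual_norm_le => x x1; rewrite -[(b *: h) x]/(b * h x) normrM.
  by rewrite ler_wpM2l// dual_norm_ub.
apply/eqP; rewrite eq_le le/=.
have [->|a0] := eqVneq a 0; first by rewrite normr0 mul0r dual_norm_ge0.
rewrite -ler_pdivlMl ?normr_gt0// -normfV.
by rewrite -[f in leLHS](scalerK a0) le.
Qed.

Lemma dual_norm_eq0 f : dual_norm f = 0 -> f = 0.
Proof.
move=> f0; apply/val_inj/funext => x /=.
have [->|x0] := eqVneq x 0; first by rewrite dual0.
have : `|f (`|x|^-1 *: x)| <= 0.
  by rewrite -f0 dual_norm_ub// normrZ normfV normr_id mulVf// normr_eq0.
rewrite dualZ normr_le0 mulf_eq0 invr_eq0.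
by rewrite normr_eq0 (negPf x0) => /eqP.
Qed.

HB.instance Definition _ :=
  Lmodule_isNormed.Build R dual dual_normD dual_normZ dual_norm_eq0.

Lemma dual_le f x : `|f x| <= `|f| * `|x|.
Proof.
have [->|x0] := eqVneq x 0.
  by rewrite dual0 !normr0 mulr0.
rewrite -ler_pdivrMr ?normr_gt0//.
have := @dual_norm_ub f (`|x|^-1 *: x).
rewrite dualZ normrM normfV normr_id mulrC; apply.
by rewrite normrZ normfV normr_id mulVf// normr_eq0.
Qed.

End Dual.
Arguments contlin {R} E.
Arguments dual {R} E.

Section Notions.
Context (R : realType) (E : normedModType R).

(* the coarsest topology on E making every element of the dual continuous *)
Definition weak_topology :=
  sup_topology (fun f : dual E => Topological.class (initial_topology f)).

HB.instance Definition _ := Topological.on weak_topology.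

Definition weakly_compact (A : set E) := compact (A : set weak_topology).

Lemma eval_contlin (x : E) : (fun f : dual E => f x) \in contlin (dual E).
Proof.
apply/contlinP.
have l : linear ((fun f : dual E => f x) : dual E -> R^o) by [].
split=> //.
pose lin := GRing.isLinear.Build R (dual E) R^o _ _ l.
pose L : {linear dual E -> R^o} := HB.pack (fun f : dual E => f x) lin.
apply: (@bounded_linear_continuous _ _ _ L); apply/linear_boundedP.
near=> r => f; rewrite (le_trans (dual_le f x))// mulrC ler_wpM2r//.
by near: r; apply: nbhs_pinfty_ge; rewrite num_real.
Unshelve. all: by end_near. Qed.

Definition bidual_embedding (x : E) : dual (dual E) := Dual (eval_contlin x).

Definition reflexive_space := forall Phi : dual (dual E),
  exists x : E, bidual_embedding x = Phi.

Definition extreme_point (A : set E) (x : E) :=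
  A x /\ forall (y z : E) (t : R), A y -> A z -> 0 < t < 1 ->
    x = t *: y + (1 - t) *: z -> y = x /\ z = x.

(* sequences are indexed from 0, so that [u n] is the term of rank n.+1 *)
Definition cesaro_summable (u : E ^nat) (x : E) :=
  n.+1%:R^-1 *: series u n.+1 @[n --> \oo] --> x.

End Notions.
Arguments reflexive_space {R} E.

(* Main.v *)
From HB Require Import structures.
Require Import Defs.
From mathcomp Require Import all_boot all_order all_algebra.
From mathcomp Require Import all_classical all_reals.
From mathcomp Require Import topology normedtype sequences derive convex.
From mathcomp Require Import interval_inference lra ring.

Set Implicit Arguments.
Unset Strict Implicit.
Unset Printing Implicit Defensive.

Import Order.TTheory GRing.Theory Num.Theory.
Import numFieldNormedType.Exports.
Local Open Scope classical_set_scope.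
Local Open Scope ring_scope.

(** The extreme points of a weakly compact set [A] are rich enough that [A] lies
in the norm closure of the set of their finite averages (repetitions allowed),
and any point of such a closure is a Cesàro limit.

The first half is the Krein-Milman theorem in norm form. Averages of lists of
extreme points approximate all their convex combinations, because rational
weights amount to repetitions; so the closure [C] of the set of averages is
convex. A point [x] of [A] outside [C] would be strictly separated from [C] by
a continuous linear functional [f]. But [f] is weakly continuous, and the
points of [A] where it is maximal form a weakly closed face; by Zorn's lemma
this face contains a minimal face, which is a single point because functionals
separate points. That point is extreme in [A], hence lies in [C], and [f] takes
there a value at least [f x]: a contradiction ([extreme_point_maximizes],
[krein_milman]).

Separation comes from Hahn-Banach in the sandwich form of Mazur and Orlicz
([mazur_orlicz]). Among the sublinear functionals below a given one there is a
minimal one, and minimality forces linearity. The same operation [lowering]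
serves twice: to show that a minimal sublinear functional is additive, and to
impose the lower bound on a convex set before minimising.

For the second half ([closure_averages_cesaro]), choose lists [s_k] whose
averages are within [1/(k+1)] of [x]. Running cyclically through one list, the
partial sums stay within a constant [B_k] of the corresponding multiples of its
average. The sequence at time [i] uses the entry of index [i] modulo the length
of [s_k], where [k = kappa i] tends to infinity so slowly that the total cost of
the switches and of the current unfinished cycle, at most
[(2 kappa n + 1) B_(kappa n)] up to time [n], is negligible before [n].

Finally, the unit ball of a reflexive space is weakly compact
([reflexive_ball_weakly_compact]): along an ultrafilter on the ball every
functional converges, the limit is a bounded linear form on the dual, and the
point representing it is the weak limit. *)

(** * Zorn's lemma for minimal elements *)

(** The witness [t0] bounds the empty chain below, so that lower bounds are only
asked of nonempty chains, where infima and intersections behave well. *)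
Lemma Zorn_min (T : Type) (P : set T) (R : T -> T -> Prop) (t0 : T) :
  P t0 ->
  (forall t, R t t) -> (forall r s t, R r s -> R s t -> R r t) ->
  (forall s t, R s t -> R t s -> s = t) ->
  (forall A : set T, A !=set0 -> A `<=` P -> total_on A R ->
    exists2 t, P t & forall s, A s -> R t s) ->
  exists2 t, P t & forall s, P s -> R s t -> s = t.
Proof.
move=> Pt0 Rxx Rtr Ras Rch.
pose S (a b : {x | P x}) := `[< R (sval b) (sval a) >].
have [| | | |[t Pt] tmin] := @Zorn _ S.
- by move=> t; apply/asboolP.
- by move=> a b c /asboolP ab /asboolP bc; apply/asboolP; exact: Rtr ab.
- move=> [a Pa] [b Pb] /asboolP/= ba /asboolP/= ab.
  have E := Ras _ _ ab ba; case: _ / E in Pb ba ab *.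
  by congr exist; exact: Prop_irrelevance.
- move=> A Atot.
  have [[a Aa]|A0] := pselect (A !=set0); last first.
    by exists (exist P t0 Pt0) => s As; case: A0; exists s.
  have [| |s t [s' As' <-] [t' At' <-]|t Pt tle] := Rch [set sval x | x in A].
  + by exists (sval a), a.
  + by move=> _ [[b Pb] _ <-].
  + by have [/asboolP|/asboolP] := Atot _ _ As' At'; [right|left].
  + by exists (exist P t Pt) => s As; apply/asboolP; apply: tle; exists s.
exists t => // s Ps Rst.
have /(_ _)/(congr1 sval) := tmin (exist P s Ps); apply.
exact/asboolP.
Qed.

(** * Minimal sublinear functionals and the Hahn-Banach theorem *)

Lemma convex_setP (R : numDomainType) (V : lmodType R) (D : set V) :
  convex_set D <-> forall w w' (l : R), D w -> D w' -> 0 <= l <= 1 ->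
    D (l *: w + (1 - l) *: w').
Proof.
split=> [cD w w' l Dw Dw' /andP[l0 l1]|cD w w' l /set_mem Dw /set_mem Dw'].
  by have /(_ (Itv01 l0 l1))/set_mem := cD w w' _ (mem_set Dw) (mem_set Dw').
by apply/mem_set; apply: cD => //; apply/andP; split.
Qed.

Lemma convex_set1 (R : numDomainType) (V : lmodType R) (x : V) :
  convex_set [set x].
Proof.
apply/convex_setP => _ _ l -> -> _.
by rewrite /= -scalerDl addrC subrK scale1r.
Qed.

Section Sublinear.
Context (R : realType) (V : lmodType R).
Implicit Types (p q : V -> R) (D : set V).

(** Inequality suffices for homogeneity: at [t = 0] it gives [p 0 <= 0], and for
[t > 0] the converse follows by applying it to the inverse of [t]. *)
Definition sublinear p :=
  (forall x y, p (x + y) <= p x + p y) /\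
  (forall t x, 0 <= t -> p (t *: x) <= t * p x).

Lemma sublinear0 p : sublinear p -> p 0 = 0.
Proof.
move=> [pD pZ]; apply/eqP; rewrite eq_le.
have := pZ 0 0 (lexx 0); rewrite scale0r mul0r => ->/=.
by have := pD 0 0; rewrite addr0; lra.
Qed.

Lemma sublinearZ p t x : sublinear p -> 0 <= t -> p (t *: x) = t * p x.
Proof.
move=> sp; rewrite le_eqVlt => /predU1P[<-|t0].
  by rewrite scale0r mul0r sublinear0.
apply/eqP; rewrite eq_le (sp.2 _ _ (ltW t0))/=.
rewrite -ler_pdivlMl// -[x in leLHS](scalerK (lt0r_neq0 t0)).
by rewrite sp.2// invr_ge0 ltW.
Qed.

Lemma sublinear_opp p x : sublinear p -> - p (- x) <= p x.
Proof. by move=> sp; have := sp.1 x (- x); rewrite subrr sublinear0//; lra. Qed.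

Lemma le_mul_inf (S : set R) (t a : R) : S !=set0 -> 0 <= t ->
  (forall s, S s -> a <= t * s) -> a <= t * inf S.
Proof.
move=> S0; rewrite le_eqVlt => /predU1P[<-|t0] aS.
  by have [s /aS] := S0; rewrite !mul0r.
rewrite -ler_pdivrMl//; apply: lb_le_inf => // s /aS.
by rewrite ler_pdivrMl.
Qed.

Lemma le_add_inf (S S' : set R) (a : R) : S !=set0 -> S' !=set0 ->
  (forall s s', S s -> S' s' -> a <= s + s') -> a <= inf S + inf S'.
Proof.
move=> S0 S'0 aS; rewrite -lerBlDr; apply: lb_le_inf => // s Ss.
rewrite lerBlDr -lerBlDl; apply: lb_le_inf => // s' Ss'.
by rewrite lerBlDl aS.
Qed.

(** The largest sublinear functional [q <= p] such that [q (- w) <= - d] on [D],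
when [D] is nonempty, convex and [d <= p] on [D]. A linear form below it is thus
at least [d] on [D]. *)
Definition lowering p D (d : R) (v : V) : R :=
  inf [set r | exists t w, [/\ 0 <= t, D w & r = p (v + t *: w) - t * d]].

Section Lowering.
Variables (p : V -> R) (D : set V) (d : R).
Hypotheses (sp : sublinear p) (D0 : D !=set0) (dp : forall w, D w -> d <= p w).
Hypothesis Dcvx : convex_set D.

Let lset v :=
  [set r | exists t w, [/\ 0 <= t, D w & r = p (v + t *: w) - t * d]].

Let lset0 v : lset v !=set0.
Proof. by have [w Dw] := D0; exists (p (v + 0 *: w) - 0 * d), 0, w. Qed.

(** This is where [d <= p] on [D] matters: subadditivity gives
[p (v + t *: w) >= t * p w - p (- v)], so the infimum is that of a set bounded
below. *)
Let lset_lb v : lbound (lset v) (- p (- v)).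
Proof.
move=> _ [t [w [t0 Dw ->]]].
have := sp.1 (- v) (v + t *: w); rewrite addKr sublinearZ//.
have := ler_wpM2l t0 (dp Dw); lra.
Qed.

Lemma lowering_le v t w : 0 <= t -> D w ->
  lowering p D d v <= p (v + t *: w) - t * d.
Proof.
move=> t0 Dw; apply: ge_inf; last by exists t, w.
by exists (- p (- v)); exact: lset_lb.
Qed.

Lemma lowering_le_self v : lowering p D d v <= p v.
Proof.
have [w Dw] := D0; have := @lowering_le v 0 w (lexx 0) Dw.
by rewrite scale0r addr0 mul0r subr0.
Qed.

(** Convexity of [D] says that the cone over [D] is closed under addition, with
the coefficients adding up; that makes [lowering] subadditive. *)
Lemma cone_add t s w w' : 0 <= t -> 0 <= s -> D w -> D w' ->
  exists2 w'', D w'' & t *: w + s *: w' = (t + s) *: w''.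
Proof.
move=> t0 s0 Dw Dw'; have [ts0|ts0] := eqVneq (t + s) 0.
  have [-> ->] : t = 0 /\ s = 0 by split; lra.
  by exists w; rewrite // addr0 !scale0r addr0.
exists ((t / (t + s)) *: w + (1 - t / (t + s)) *: w').
  apply: (iffLR (convex_setP D) Dcvx) => //; rewrite divr_ge0 ?addr_ge0//=.
  by rewrite ler_pdivrMr ?lt0r ?ts0 ?addr_ge0// mul1r; lra.
rewrite scalerDr !scalerA mulrBr mulr1 mulrCA mulfV// mulr1.
by rewrite (addrC t s) addrK.
Qed.

Lemma sublinear_lowering : sublinear (lowering p D d).
Proof.
split=> [x y|t x t0].
  apply: le_add_inf; try exact: lset0.
  move=> _ _ [t [w [t0 Dw ->]]] [s [w' [s0 Dw' ->]]].
  have [w'' Dw'' E] := cone_add t0 s0 Dw Dw'.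
  apply: (le_trans (@lowering_le _ (t + s) _ (addr_ge0 t0 s0) Dw'')).
  by have := sp.1 (x + t *: w) (y + s *: w'); rewrite addrACA E; lra.
apply: le_mul_inf => //; first exact: lset0.
move=> _ [s [w [s0 Dw ->]]].
apply: (le_trans (@lowering_le _ (t * s) _ (mulr_ge0 t0 s0) Dw)).
by rewrite -scalerA -scalerDr sublinearZ//; lra.
Qed.

End Lowering.

(** Zorn's lemma applies because the pointwise infimum of a chain of sublinear
functionals is sublinear: it is finite since each member [q] of the chain
satisfies [- p (- x) <= - q (- x) <= q x], and for subadditivity two members can
be replaced by the smaller of them. *)
Lemma sublinear_minimal p : sublinear p -> exists2 q,
  sublinear q /\ (forall x, q x <= p x) &
  forall q', sublinear q' -> (forall x, q' x <= q x) -> q' = q.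
Proof.
move=> sp.
pose P := [set q | sublinear q /\ (forall x, q x <= p x)].
have [| | | | |q [sq qp] qmin] :=
  @Zorn_min _ P (fun q q' => forall x, q x <= q' x) p.
- by split.
- by [].
- by move=> r s t rs st x; exact: le_trans (rs x) (st x).
- by move=> s t st ts; apply/funext => x; apply/eqP; rewrite eq_le st ts.
- move=> A [q0 Aq0] AP Atot.
  have lb x : lbound [set q x | q in A] (- p (- x)).
    move=> _ [q Aq <-]; have [sq qp] := AP _ Aq.
    by apply: le_trans (sublinear_opp _ sq); rewrite lerN2.
  have A0 x : [set q x | q in A] !=set0 by exists (q0 x), q0.
  have infA x q : A q -> inf [set q x | q in A] <= q x.
    by move=> Aq; apply: ge_inf; [exists (- p (- x)); exact: lb|exists q].
  exists (fun x => inf [set q x | q in A]); last by move=> q Aq x; exact: infA.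
  split; last by move=> x; exact: le_trans (infA _ _ Aq0) ((AP _ Aq0).2 x).
  split=> [x y|t x t0].
    apply: le_add_inf => // _ _ [q Aq <-] [q' Aq' <-].
    have [qq'|q'q] := Atot _ _ Aq Aq'.
      apply: (le_trans (infA _ _ Aq)); apply: (le_trans ((AP _ Aq).1.1 _ _)).
      by rewrite lerD2l.
    apply: (le_trans (infA _ _ Aq')); apply: (le_trans ((AP _ Aq').1.1 _ _)).
    by rewrite lerD2r.
  apply: le_mul_inf => // _ [q Aq <-].
  by apply: (le_trans (infA _ _ Aq)); exact: (AP _ Aq).1.2.
exists q => // q' sq' q'q; apply: qmin => //; split => // x.
exact: le_trans (qp x).
Qed.

(** Lowering [q] by the single constraint [q (- y) <= - q y] cannot change a
minimal [q]; with coefficient [1] this reads [q x <= q (x + y) - q y], the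
missing half of additivity. *)
Lemma sublinear_minimal_linear q : sublinear q ->
  (forall q', sublinear q' -> (forall x, q' x <= q x) -> q' = q) ->
  linear (q : V -> R^o).
Proof.
move=> sq qmin.
have qD x y : q (x + y) = q x + q y.
  apply/eqP; rewrite eq_le sq.1/=.
  have y1 : [set y] !=set0 by exists y.
  have yq w : [set y] w -> q y <= q w by move=> ->.
  have ycvx : convex_set [set y] by exact: convex_set1.
  have {1}<- : lowering q [set y] (q y) = q.
    apply: qmin; first exact: sublinear_lowering.
    exact: lowering_le_self.
  by have := lowering_le sq yq x ler01 (erefl y); rewrite scale1r mul1r; lra.
have qN x : q (- x) = - q x.
  by have := qD x (- x); rewrite subrr sublinear0//; lra.
have qZ a x : q (a *: x) = a * q x.
  have [a0|/ltW a0] := leP 0 a; first exact: sublinearZ.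
  by rewrite -[a]opprK scaleNr qN sublinearZ ?oppr_ge0// !mulNr.
by move=> a x y; rewrite qD qZ.
Qed.

(** A minimal sublinear functional below [lowering p D d] is linear and below [p];
the constraint at [- w] turns into the lower bound at [w]. *)
Theorem mazur_orlicz p D (d : R) : sublinear p -> D !=set0 ->
  convex_set D -> (forall w, D w -> d <= p w) ->
  exists f : V -> R, [/\ linear (f : V -> R^o), forall x, f x <= p x &
    forall w, D w -> d <= f w].
Proof.
move=> sp D0 Dcvx dp.
have [f [sf fp] fmin] := sublinear_minimal (sublinear_lowering sp D0 dp Dcvx).
exists f; split; first exact: sublinear_minimal_linear.
  by move=> x; apply: le_trans (fp x) _; exact: lowering_le_self.
move=> w Dw.
have := fp (- w); have := lowering_le sp dp (- w) ler01 Dw.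
rewrite scale1r mul1r addNr sublinear0//.
have := sublinear_opp w sf; lra.
Qed.

End Sublinear.

(** * Separation by continuous functionals *)

Section Separation.
Context (R : realType) (E : normedModType R).

Lemma norm_dominated_contlin (f : E -> R) : linear (f : E -> R^o) ->
  (forall x, f x <= `|x|) -> f \in contlin E.
Proof.
move=> lf fle; apply/contlinP; split => //.
pose lin := GRing.isLinear.Build R E R^o _ _ lf.
pose L : {linear E -> R^o} := HB.pack f lin.
apply: (@bounded_linear_continuous _ _ _ L); apply/linear_boundedP.
exists 1; split; first exact: num_real.
move=> r r1 x; apply: (@le_trans _ _ `|x|); last first.
  by rewrite ler_peMl// ltW.
rewrite ler_norml fle andbT -[leRHS]opprK lerN2.
by rewrite -[- _](linearN L) -[leRHS]normrN; exact: fle.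
Qed.

(** The Mazur-Orlicz theorem for the norm and the convex set [x - C]: on it the
norm is at least [d], so some linear form below the norm is at least [d] too. *)
Theorem separation (C : set E) (x : E) (d : R) : C !=set0 ->
  convex_set C -> (forall y, C y -> d <= `|x - y|) ->
  exists f : dual E, forall y, C y -> f y + d <= f x.
Proof.
move=> [c Cc] /convex_setP Ccvx dC.
have sn : sublinear (fun v : E => `|v|).
  by split=> [u v|t u t0]; [exact: ler_normD|rewrite normrZ ger0_norm].
have [| | |f [lf fn fC]] := @mazur_orlicz _ _ _ [set x - y | y in C] d sn.
- by exists (x - c), c.
- apply/convex_setP => _ _ l [y Cy <-] [z Cz <-] l01.
  exists (l *: y + (1 - l) *: z); first exact: Ccvx.
  by rewrite !scalerBr addrACA -scalerDl (addrC l) subrK scale1r opprD.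
- by move=> _ [y Cy <-]; exact: dC.
pose F := Dual (norm_dominated_contlin lf fn); exists F => y Cy.
have : d <= F (x - y) by apply: fC; exists y.
by rewrite (linearB (F : {linear E -> R^o})) -[X in _ <= X]/(F x - F y); lra.
Qed.

Lemma dual_separates (x y : E) : x != y -> exists f : dual E, f y < f x.
Proof.
move=> xy; have [||z ->//|f fy] := @separation [set y] x `|x - y|.
- by exists y.
- exact: convex_set1.
exists f; have := fy y erefl; have : 0 < `|x - y| by rewrite normr_gt0 subr_eq0.
lra.
Qed.

End Separation.

(** * Faces and extreme points of weakly compact sets *)

Section Faces.
Context (R : realType) (E : normedModType R).
Local Notation W := (weak_topology E).

Lemma dual_weak_continuous (f : dual E) : continuous (f : W -> R).
Proof.
move=> x; have /cvg_sup/(_ f) xf : nbhs (x : W) --> (x : W) by [].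
exact: cvg_trans (cvg_app f xf) (@initial_continuous E R f x).
Qed.

(** This makes weakly compact sets weakly closed, hence faces of themselves. *)
Lemma weak_hausdorff : hausdorff_space W.
Proof.
move=> x y clxy; apply: contrapT => /eqP xy.
have [f fxy] := dual_separates xy.
have [z [/= zx zy]] : [set z : W | f x - (f x - f y) / 2 < f z] `&`
    [set z : W | f z < f x - (f x - f y) / 2] !=set0.
  apply: clxy.
    apply: (@dual_weak_continuous f x [set r | f x - (f x - f y) / 2 < r]).
    by apply: lt_nbhsr; lra.
  apply: (@dual_weak_continuous f y [set r | r < f x - (f x - f y) / 2]).
  by apply: lt_nbhsl; lra.
by have := lt_trans zx zy; rewrite ltxx.
Qed.

Definition face (A F : set E) :=
  [/\ F !=set0, F `<=` A, closed (F : set W) &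
    forall y z (t : R), A y -> A z -> 0 < t < 1 ->
      F (t *: y + (1 - t) *: z) -> F y /\ F z].

Lemma face_self (A : set E) : A !=set0 -> weakly_compact A -> face A A.
Proof.
by move=> A0 cA; split => //; exact: compact_closed weak_hausdorff cA.
Qed.

Lemma dual_convE (f : dual E) (t : R) y z :
  f (t *: y + (1 - t) *: z) = t * f y + (1 - t) * f z.
Proof. by rewrite dual_linear dualZ. Qed.

(** At an inner point of a segment a linear functional cannot reach its maximum
over [F] unless it does so at both ends. *)
Lemma face_argmax (A F : set E) (f : dual E) : weakly_compact A ->
  face A F -> face A [set x | F x /\ forall y, F y -> f y <= f x].
Proof.
move=> cA [F0 FA clF eF].
have cF : compact (F : set W) := subclosed_compact clF cA FA.
have [c /set_mem Fc fc] := @compact_EVT_max W R f F F0 cF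
  (continuous_subspaceT (@dual_weak_continuous f)).
have fcF y : F y -> f y <= f c by move=> Fy; apply: fc; rewrite inE.
split.
- by exists c.
- by move=> x [/FA].
- rewrite (_ : mkset _ = (F : set W) `&` (f : W -> R) @^-1` [set r | f c <= r]).
    apply: closedI => //; apply: preimage_closed; last exact: closed_ge.
    by move=> x _; exact: dual_weak_continuous.
  apply/seteqP; split => x /= [Fx fx]; split => //; first exact: fx.
  by move=> y Fy; exact: le_trans (fcF _ Fy) fx.
- move=> y z t Ay Az t01 [/eF -/(_ Ay Az t01)[Fy Fz] fm].
  have := fm _ Fc; have := fcF _ Fy; have := fcF _ Fz.
  rewrite dual_convE; case/andP: t01 => t0 t1 fz fy fyz.
  (* [f y, f z <= f c] and the weights are positive, so both are equalities. *)
  have fyc : f c <= f y by nra.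
  have fzc : f c <= f z by nra.
  by split; split => // u /fcF Fu; apply: le_trans Fu _.
Qed.

(** The members of the chain form a filter base on [A], and a cluster point of
it lies in every member since these are closed. *)
Lemma chain_inter_face (A : set E) (Fs : set (set E)) : weakly_compact A ->
  Fs !=set0 -> Fs `<=` face A -> total_on Fs subset ->
  face A (\bigcap_(F in Fs) F).
Proof.
move=> cA [F0 FsF0] Fsface Fstot.
have FF : ProperFilter (filter_from Fs id : set_system W).
  apply: filter_from_proper; last by move=> F /Fsface[].
  apply: filter_from_filter; first by exists F0.
  move=> F G FsF FsG; have [FG|GF] := Fstot _ _ FsF FsG.
    by exists F => // x Fx; split => //; exact: FG.
  by exists G => // x Gx; split => //; exact: GF.
split.
- have [|p [_ clp]] := cA _ FF; first by exists F0 => //; case: (Fsface _ FsF0).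
  exists p => F FsF; have [_ _ clF _] := Fsface _ FsF; apply: clF => B pB.
  by apply: clp => //; exists F.
- by case: (Fsface _ FsF0) => _ F0A _ _ x /(_ _ FsF0) /F0A.
- by apply: closed_bigI => F /Fsface[].
- move=> y z t Ay Az t01 Fyz; split => F FsF; have [_ _ _ eF] := Fsface _ FsF.
    by have [] := eF _ _ _ Ay Az t01 (Fyz _ FsF).
  by have [] := eF _ _ _ Ay Az t01 (Fyz _ FsF).
Qed.

(** A minimal face is a single point: if a functional took distinct values at
two of its points, the face where it is maximal would be smaller. *)
Lemma face_extreme_point (A F : set E) : weakly_compact A -> face A F ->
  exists2 e, F e & extreme_point A e.
Proof.
move=> cA fF.
pose P := [set G | face A G /\ G `<=` F].
have [| | | | |G [fG GF] Gmin] := @Zorn_min _ P subset F.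
- by split.
- by move=> X x.
- by move=> X Y Z; exact: subset_trans.
- by move=> X Y XY YX; apply/seteqP.
- move=> Fs [G0 FsG0] FsP Fstot; exists (\bigcap_(G in Fs) G).
    split; last by move=> x /(_ _ FsG0); exact: (FsP _ FsG0).2.
    by apply: chain_inter_face => //; [exists G0|move=> G /FsP[]].
  by move=> G FsG x; exact.
have G_single x y : G x -> G y -> x = y.
  move=> Gx Gy; apply: contrapT => /eqP/dual_separates[f fyx].
  have : [set x | G x /\ forall y, G y -> f y <= f x] y.
    rewrite (Gmin [set x | G x /\ forall y, G y -> f y <= f x])//.
      split; first exact: face_argmax.
      by move=> z [/GF].
    by move=> z [].
  by move=> [_ /(_ _ Gx)]; rewrite leNgt fyx.
have [[e Ge] GA _ eG] := fG.
exists e; first exact: GF.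
split; first exact: GA.
move=> y z t Ay Az t01 E'; have [Gy Gz] : G y /\ G z.
  by apply: (eG _ _ t) => //; rewrite -E'.
by split; exact: G_single.
Qed.

Theorem extreme_point_maximizes (A : set E) (f : dual E) : A !=set0 ->
  weakly_compact A ->
  exists2 e, extreme_point A e & forall y, A y -> f y <= f e.
Proof.
move=> A0 cA.
have fA := face_argmax f cA (face_self A0 cA).
have [e [_ fe] ee] := face_extreme_point cA fA.
by exists e.
Qed.

End Faces.

(** * Averages of extreme points and the Krein-Milman theorem *)

Section Averages.
Context (R : realType) (E : normedModType R).

Definition average (s : seq E) : E := (size s)%:R^-1 *: \sum_(y <- s) y.

(** Lists may repeat points, so these are the convex combinations with rational
weights. *)
Definition averages (A : set E) : set E :=
  [set average s | s in [set s | s != [::] /\ forall y, y \in s -> A y]].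

Lemma closure_distP (B : set E) (x : E) :
  closure B x <-> forall e, 0 < e -> exists2 b, B b & `|x - b| < e.
Proof.
split=> [clx e e0|h A /nbhs_ballP[e /= e0 eA]].
  have [b [Bb]] := clx _ (nbhsx_ballx x e e0).
  by rewrite -ball_normE; exists b.
have [b Bb xb] := h _ e0; exists b; split => //.
by apply: eA; rewrite -ball_normE.
Qed.

(** For averages of lists [s] and [s'], take [k * size s'] copies of [s] and
[(n - k) * size s] copies of [s']: the cross factors compensate for the
different lengths. *)
Lemma average_conv (A : set E) v w (k n : nat) : (0 < n)%N -> (k <= n)%N ->
  averages A v -> averages A w ->
  averages A ((k%:R / n%:R) *: v + (1 - k%:R / n%:R) *: w).
Proof.
move=> n0 kn [s [s0 sA] <-] [s' [s'0 s'A] <-].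
pose t :=
  flatten (nseq (k * size s') s) ++ flatten (nseq ((n - k) * size s) s').
have size_copies m (r : seq E) : size (flatten (nseq m r)) = (m * size r)%N.
  by elim: m => //= m IH; rewrite size_cat IH mulSn.
have sum_copies m (r : seq E) :
    \sum_(y <- flatten (nseq m r)) y = m%:R *: \sum_(y <- r) y.
  elim: m => [|m IH] /=; first by rewrite big_nil scale0r.
  by rewrite big_cat IH /= mulrS scalerDl scale1r.
have mem_copies m (r : seq E) y : y \in flatten (nseq m r) -> y \in r.
  by elim: m => //= m IH; rewrite mem_cat => /orP[//|/IH].
have nz (r : seq E) : r != [::] -> (size r)%:R != 0 :> R.
  by rewrite pnatr_eq0 size_eq0.
have nzn : n%:R != 0 :> R by rewrite pnatr_eq0 -lt0n.
have size_t : size t = (n * (size s * size s'))%N.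
  rewrite size_cat !size_copies -!mulnA (mulnC (size s')) -mulnDl.
  by rewrite subnKC.
exists t.
  split; last first.
    by move=> y; rewrite mem_cat => /orP[] /mem_copies; [exact: sA|exact: s'A].
  rewrite -size_eq0 size_t !muln_eq0 !size_eq0 !negb_or s0 s'0.
  by rewrite -lt0n n0.
rewrite /average size_t big_cat !sum_copies /= scalerDr !scalerA.
by congr (_ *: _ + _ *: _); rewrite !natrM ?natrB//; field; rewrite nzn !nz.
Qed.

(** Given averages [v'] and [w'] close to the two points, the real weight [l] is
replaced by [k / n] with [k] the integer part of [l * n]; this moves their convex
combination by at most [`|v' - w'| / n]. *)
Lemma convex_closure_averages (A : set E) : convex_set (closure (averages A)).
Proof.
apply/convex_setP => v w l /closure_distP clv /closure_distP clw /andP[l0 l1].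
apply/closure_distP => e e0; have e20 : 0 < e / 2 by rewrite divr_gt0.
have [v' Av' vv'] := clv _ e20; have [w' Aw' ww'] := clw _ e20.
pose n := (Num.truncn (`|v' - w'| / (e / 2))).+1.
have n0 : 0 < n%:R :> R by rewrite ltr0n.
pose k := Num.truncn (l * n%:R).
have /andP[kl lk] : k%:R <= l * n%:R < k.+1%:R.
  by apply: truncn_itv; rewrite mulr_ge0// ltW.
have kn : (k <= n)%N by rewrite -(ler_nat R) (le_trans kl)// ler_piMl// ltW.
exists ((k%:R / n%:R) *: v' + (1 - k%:R / n%:R) *: w').
  exact: average_conv.
set r := k%:R / n%:R.
apply: (le_lt_trans (ler_distD (l *: v' + (1 - l) *: w') _ _)).
rewrite [ltRHS]splitr; apply: ler_ltD.
  rewrite opprD addrACA -!scalerBr; apply: (le_trans (ler_normD _ _)).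
  rewrite !normrZ (ger0_norm l0) ger0_norm ?subr_ge0//.
  have := ler_wpM2l l0 (ltW vv').
  have : (1 - l) * `|w - w'| <= (1 - l) * (e / 2).
    by rewrite ler_wpM2l ?subr_ge0// ltW.
  lra.
rewrite opprD addrACA -!scalerBl.
have -> : 1 - l - (1 - r) = - (l - r) by ring.
rewrite scaleNr -scalerBr normrZ.
have lr : `|l - r| <= n%:R^-1.
  rewrite -[l](mulfK (lt0r_neq0 n0)) -mulrBl normrM normfV normr_nat.
  rewrite ler_pdivrMr// mulVf ?lt0r_neq0// ger0_norm ?subr_ge0//.
  by move: lk; rewrite -natr1; lra.
apply: (le_lt_trans (ler_wpM2r (normr_ge0 _) lr)).
rewrite mulrC ltr_pdivrMr// mulrC -ltr_pdivrMr//.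
exact: truncnS_gt.
Qed.

(** A functional separating [x] from the closed convex hull of the extreme
points would exceed, at [x], its value at an extreme point where it is maximal. *)
Theorem krein_milman (A : set E) : weakly_compact A ->
  A `<=` closure (averages (extreme_point A)).
Proof.
move=> cA x Ax; apply: contrapT => nclx.
have [d d0 xd] : exists2 d, 0 < d &
    forall y, closure (averages (extreme_point A)) y -> d <= `|x - y|.
  apply: contrapT => nd; apply: nclx; apply/closure_distP => e e0.
  apply: contrapT => ne; apply: nd; exists (e / 2); first by rewrite divr_gt0.
  move=> y /closure_distP /(_ (e / 2))[|z Az yz]; first by rewrite divr_gt0.
  rewrite leNgt; apply/negP => xy; apply: ne; exists z => //.
  by rewrite (le_lt_trans (ler_distD y _ _))// [ltRHS]splitr ltrD.
have A0 : A !=set0 by exists x.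
have ave e : extreme_point A e -> closure (averages (extreme_point A)) e.
  move=> Ae; apply: subset_closure; exists [:: e].
    by split=> // y; rewrite inE => /eqP ->.
  by rewrite /average big_seq1 invr1 scale1r.
have [|f fx] := separation _ (@convex_closure_averages _) xd.
  by have [e Ae _] := extreme_point_maximizes 0 A0 cA; exists e; exact: ave.
have [e Ae fe] := extreme_point_maximizes f A0 cA.
by have := fx _ (ave _ Ae); have := fe _ Ax; lra.
Qed.

End Averages.

(** * Cesàro sums *)

Section Cesaro.
Context (R : realType) (E : normedModType R).

(** Partial sums of the periodic sequence that runs through [s], recentred at
its average. *)
Definition cycle_dev (s : seq E) (n : nat) : E :=
  \sum_(i < n) (s`_(i %% size s) - average s).

Lemma cycle_devS s n :
  cycle_dev s n.+1 = cycle_dev s n + (s`_(n %% size s) - average s).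
Proof. by rewrite /cycle_dev big_ord_recr. Qed.

(** The sum over a full period vanishes, so the deviation is periodic. *)
Lemma cycle_dev_bounded s : s != [::] ->
  exists B, forall n, `|cycle_dev s n| <= B.
Proof.
rewrite -size_eq0 -lt0n => s0.
have dev_period : cycle_dev s (size s) = 0.
  rewrite /cycle_dev sumrB sumr_const card_ord.
  rewrite (eq_bigr (fun i : 'I_(size s) => s`_i)); last first.
    by move=> i _; rewrite modn_small.
  rewrite -(big_mkord xpredT (fun i => s`_i)) -(big_nth 0 xpredT id) /average.
  rewrite -scaler_nat scalerA mulfV ?scale1r ?subrr//.
  by rewrite pnatr_eq0 -lt0n.
have devD n : cycle_dev s (n + size s) = cycle_dev s n.
  elim: n => [|n IH]; first by rewrite add0n dev_period /cycle_dev big_ord0.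
  by rewrite addSn !cycle_devS IH modnDr.
have dev_mod n : cycle_dev s n = cycle_dev s (n %% size s).
  rewrite {1}(divn_eq n (size s)); elim: (n %/ size s)%N => // q IH.
  by rewrite mulSn -addnA addnC devD.
exists (\sum_(j < size s) `|cycle_dev s j|) => n.
rewrite dev_mod (bigD1 (Ordinal (ltn_pmod n s0)))//=.
by rewrite lerDl sumr_ge0.
Qed.

(** Take for [kappa n] the largest [k <= n] with [k * B k <= n]. The factor [k]
in front makes [B (kappa n)] negligible before [n] as [kappa n] grows. *)
Lemma slow_index (B : nat -> R) : exists kappa : nat -> nat,
  [/\ {homo kappa : m n / (m <= n)%N},
      forall K, \forall n \near \oo, (K <= kappa n)%N &
      forall n, (kappa n)%:R * B (kappa n) <= n%:R].
Proof.
pose P n (k : 'I_n.+1) := k%:R * B k <= n%:R.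
pose kappa n : nat := [arg max_(k > ord0 | P n k) (k : nat)].
have kappaP n : [/\ (kappa n <= n)%N, (kappa n)%:R * B (kappa n) <= n%:R &
    forall k, (k <= n)%N -> k%:R * B k <= n%:R -> (k <= kappa n)%N].
  rewrite /kappa; case: arg_maxnP => [|i Pi imax]; first by rewrite /P mul0r.
  split; [by rewrite -ltnS | by [] |].
  by move=> k kn; apply: (imax (Ordinal (kn : (k < n.+1)%N))).
exists kappa; split.
- move=> m n mn; have [km Bm _] := kappaP m; have [_ _] := kappaP n; apply.
    exact: leq_trans mn.
  by rewrite (le_trans Bm)// ler_nat.
- move=> K; near=> n; have [_ _] := kappaP n; apply.
    by near: n; exact: nbhs_infty_ge.
  by near: n; exact: nbhs_infty_ger.
- by move=> n; have [] := kappaP n.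
Unshelve. all: by end_near. Qed.

(** The sequence follows the cycle of the list [s (kappa i)] at time [i]. Each
change of list costs at most twice the current bound on the deviations, and
[kappa] changes at most [kappa n] times up to [n]; the averages of the lists
themselves are handled by Cesàro's lemma. *)
Theorem closure_averages_cesaro (A : set E) (x : E) :
  closure (averages A) x ->
  exists u : E ^nat, (forall n, A (u n)) /\ cesaro_summable u x.
Proof.
move=> /closure_distP clx.
have /choice[s sP] (k : nat) : exists s : seq E,
    [/\ s != [::], forall y, y \in s -> A y & `|x - average s| < k.+1%:R^-1].
  have [|_ [s [s0 sA] <-] xs] := clx (k.+1%:R^-1); first by rewrite invr_gt0.
  by exists s.
have /choice[B0 B0P] (k : nat) :
    exists B, forall n, `|cycle_dev (s k) n| <= B.
  by have [s0 _ _] := sP k; exact: cycle_dev_bounded.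
(* Partial sums make the bounds nondecreasing, so that all switches up to time
   [n] are controlled by the last bound. *)
pose B k := \sum_(j < k.+1) B0 j.
have B00 k : 0 <= B0 k by apply: le_trans (B0P k 0%N).
have BP k n : `|cycle_dev (s k) n| <= B k.
  by rewrite (le_trans (B0P k n))// /B big_ord_recr/= lerDr sumr_ge0.
have B_homo : {homo B : j k / (j <= k)%N >-> j <= k}.
  apply: homo_leq => [//||k]; first exact: le_trans.
  by rewrite /B [leRHS]big_ord_recr/= lerDl.
have Bge0 k : 0 <= B k by apply: sumr_ge0.
(* Here [2k + 1] counts two deviations for each of at most [k] switches, and
   one for the list in use. *)
have [kappa [kappa_homo kappa_oo kappaB]] :=
  slow_index (fun k => (k.*2.+1)%:R * B k).
pose u i : E := (s (kappa i))`_(i %% size (s (kappa i))).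
exists u; split.
  move=> n; have [s0 sA _] := sP (kappa n); apply/sA/mem_nth.
  by rewrite ltn_pmod// lt0n size_eq0.
(* Between switches the left-hand side is constant: the deviation subtracted
   grows by the same term as the sum. *)
have switch n : `|\sum_(i < n) (u i - average (s (kappa i)))
    - cycle_dev (s (kappa n)) n| <= (kappa n).*2%:R * B (kappa n).
  elim: n => [|n IH].
    by rewrite /cycle_dev !big_ord0 subrr normr0 mulr_ge0.
  rewrite big_ord_recr/=.
  have -> : \sum_(i < n) (u i - average (s (kappa i)))
      + (u n - average (s (kappa n))) - cycle_dev (s (kappa n.+1)) n.+1 =
    (\sum_(i < n) (u i - average (s (kappa i))) - cycle_dev (s (kappa n)) n)
    + (cycle_dev (s (kappa n)) n.+1 - cycle_dev (s (kappa n.+1)) n.+1).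
    rewrite (cycle_devS (s (kappa n))) -/(u n) !addrA.
    by rewrite subrK.
  have := kappa_homo _ _ (leqnSn n); rewrite leq_eqVlt => /predU1P[<-|lt_kappa].
    by rewrite subrr addr0.
  apply: (le_trans (ler_normD _ _)).
  have le1 : `|cycle_dev (s (kappa n)) n.+1 - cycle_dev (s (kappa n.+1)) n.+1|
      <= 2 * B (kappa n.+1).
    apply: (le_trans (ler_normB _ _)); rewrite mulr2n mulrDl !mul1r.
    by rewrite lerD// (le_trans (BP _ _))// B_homo// ltnW.
  apply: (le_trans (lerD IH le1)).
  apply: (@le_trans _ _
    ((kappa n).*2%:R * B (kappa n.+1) + 2 * B (kappa n.+1))).
    by rewrite lerD2r ler_wpM2l// B_homo// ltnW.
  by rewrite -mulrDl ler_wpM2r// -natrD ler_nat addn2 -doubleS leq_double.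
have dev_le n : `|\sum_(i < n) (u i - average (s (kappa i)))|
    <= (kappa n).*2.+1%:R * B (kappa n).
  rewrite -[X in `|X|](subrK (cycle_dev (s (kappa n)) n)).
  rewrite -natr1 mulrDl mul1r (le_trans (ler_normD _ _))// lerD//.
pose delta i := `|x - average (s (kappa i))|.
have delta0 : delta @ \oo --> (0 : R).
  apply/cvgrPdist_lt => e e0; near=> i.
  rewrite sub0r normrN ger0_norm ?normr_ge0//.
  have [_ _ /lt_trans] := sP (kappa i); apply.
  apply: (@le_lt_trans _ _ (Num.truncn e^-1).+1%:R^-1).
    rewrite lef_pV2 ?posrE// ler_nat ltnS.
    by near: i; exact: kappa_oo.
  rewrite -[ltRHS]invrK ltf_pV2 ?posrE ?invr_gt0//; exact: truncnS_gt.
apply/cvgrPdist_lt => e e0.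
have e20 : 0 < e / 2 by rewrite divr_gt0.
have /cvgrPdist_lt/(_ _ e20) mean_delta := cesaro delta0.
near=> n.
have n0 : 0 < n.+1%:R :> R by [].
have -> : x - n.+1%:R^-1 *: series u n.+1 = n.+1%:R^-1 *:
    (\sum_(i < n.+1) (x - average (s (kappa i)))
     - \sum_(i < n.+1) (u i - average (s (kappa i)))).
  rewrite -sumrB; under eq_bigr do rewrite opprB addrA subrK.
  rewrite sumrB sumr_const card_ord scalerBr -[x *+ _]scaler_nat scalerA.
  rewrite (mulVf (lt0r_neq0 n0)) scale1r.
  by rewrite /series/= big_mkord.
rewrite normrZ normfV normr_nat ltr_pdivrMl// (le_lt_trans (ler_normB _ _))//.
rewrite [e in ltRHS]splitr mulrDr ltr_leD//.
  apply: (le_lt_trans (ler_norm_sum _ _ _)); rewrite -ltr_pdivrMl//.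
  have : `|0 - arithmetic_mean delta n| < e / 2.
    by near: n; exact: mean_delta.
  rewrite sub0r normrN; apply: le_lt_trans; apply: le_trans (ler_norm _).
  by rewrite /arithmetic_mean/= /series/= big_mkord.
apply: (le_trans (dev_le _)).
set K := (Num.truncn (e / 2)^-1).+1.
have Kk : (K <= kappa n.+1)%N.
  by apply: leq_trans (kappa_homo _ _ (leqnSn n)); near: n; exact: kappa_oo.
rewrite -ler_pdivrMr//; apply: le_trans (kappaB n.+1).
rewrite [leLHS]mulrC ler_wpM2r ?mulr_ge0//.
apply: (@le_trans _ _ K%:R); last by rewrite ler_nat.
exact/ltW/truncnS_gt.
Unshelve. all: by end_near.
Qed.

End Cesaro.

(** * Weak compactness of the unit ball of a reflexive space *)

Section Reflexive.
Context (R : realType) (E : normedModType R).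
Local Notation W := (weak_topology E).

Lemma cvg_weak (F : set_system E) (x : E) : Filter F ->
  (forall f : dual E, f @ F --> f x) -> F --> (x : W).
Proof.
move=> FF Fx; apply/cvg_sup => f A /= [_ [[B Bop <-] Bfx BA]].
by apply: filterS BA _; apply: Fx; exact: open_nbhs_nbhs.
Qed.

Lemma ultra_compact_cvg (T : Type) (U : topologicalType) (f : T -> U)
    (K : set U) (F : set_system T) :
  compact K -> UltraFilter F -> F (f @^-1` K) -> exists l : U, f @ F --> l.
Proof.
move=> cK UF FK; have [l [_ cll]] := cK (f @ F) _ FK.
exists l => B lB; have [//|FnB] := in_ultra_setVsetC (f @^-1` B) UF.
by have [z [nBz Bz]] := cll (~` B) B FnB lB.
Qed.

(** If [x] were outside the unit ball, hence at distance at least [`|x| - 1] from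
it, a functional separating it from the ball would satisfy [`|f| < f x]. *)
Lemma unit_ball_dual (x : E) :
  (forall f : dual E, `|f x| <= `|f|) -> `|x| <= 1.
Proof.
move=> fx; rewrite leNgt; apply/negP => x1.
have [| | |f fB] := @separation R E [set y | `|y| <= 1] x (`|x| - 1).
- by exists 0; rewrite /= normr0.
- apply/convex_setP => y z l /= y1 z1 /andP[l0 l1].
  apply: (le_trans (ler_normD _ _)).
  rewrite !normrZ (ger0_norm l0) ger0_norm ?subr_ge0//.
  have := ler_wpM2l l0 y1.
  have : (1 - l) * `|z| <= (1 - l) * 1 by rewrite ler_wpM2l ?subr_ge0.
  lra.
- move=> y /= y1; have := lerB_dist x y; lra.
have : `|f| <= f x - (`|x| - 1).
  apply: dual_norm_le => y y1; rewrite ler_norml; apply/andP; split.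
    have := fB (- y); rewrite /= normrN => /(_ y1).
    rewrite (linearN (f : {linear E -> R^o})) -[X in X + _]/(- f y); lra.
  have := fB y y1; lra.
have := fx f; have := ler_norm (f x); lra.
Qed.

(** Along an ultrafilter containing the ball, each [f x] stays in a segment and
converges to some [phi f]. The limit [phi] is linear and bounded by the dual
norm, so reflexivity represents it by a point, which is the weak limit. *)
Theorem reflexive_ball_weakly_compact : reflexive_space E ->
  weakly_compact (closed_ball (0 : E) 1).
Proof.
move=> reflE; rewrite /weakly_compact closed_ballE//.
rewrite compact_ultra => F UF FB.
have fB (f : dual E) : \forall x \near F, `|f x| <= `|f|.
  apply: filterS FB => x; rewrite /closed_ball_/= sub0r normrN => x1.
  exact: dual_norm_ub.
have /choice[phi phiP] (f : dual E) : exists l : R, f @ F --> l.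
  apply: (ultra_compact_cvg (@segment_compact R (- `|f|) (`|f|)) UF).
  by apply: filterS (fB f) => x; rewrite /= in_itv/= ler_norml.
have phi_linear : linear (phi : dual E -> R^o).
  move=> a f g; apply: (cvg_unique (@Rhausdorff R) (phiP (a *: f + g))).
  by apply: cvgD (phiP g); apply: cvgMl_tmp; exact: phiP.
have phi_le f : `|phi f| <= `|f|.
  exact: cvgr_to_le (cvg_norm (phiP f)) (fB f).
have phi_dom f : phi f <= `|f| by apply: le_trans (phi_le f); exact: ler_norm.
have [x xphi] := reflE (Dual (norm_dominated_contlin phi_linear phi_dom)).
have fx (f : dual E) : f x = phi f.
  by have := congr1 (fun P : dual (dual E) => P f) xphi.
exists x; split.
  rewrite /closed_ball_/= sub0r normrN; apply: unit_ball_dual => f.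
  by rewrite fx.
by apply: cvg_weak => f; rewrite fx.
Qed.

End Reflexive.

Theorem corollary1 (R : realType) (E : completeNormedModType R) :
  (forall Omega : set E, weakly_compact Omega -> convex_set Omega ->
    forall x : E, Omega x ->
      exists u : E ^nat,
        (forall n, extreme_point Omega (u n)) /\ cesaro_summable u x) /\
  (reflexive_space E ->
    forall x : E, closed_ball (0 : E) 1 x ->
      exists u : E ^nat,
        (forall n, extreme_point (closed_ball (0 : E) 1) (u n)) /\
        cesaro_summable u x).
Proof.
have main (A : set E) x : weakly_compact A -> A x -> exists u : E ^nat,
    (forall n, extreme_point A (u n)) /\ cesaro_summable u x.
  by move=> cA Ax; apply: closure_averages_cesaro; exact: krein_milman.
split=> [Omega cO _ x Ox|reflE x Bx]; first exact: main.
by apply: main => //; exact: reflexive_ball_weakly_compact.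
Qed.
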